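(* Let $C$ be a non-empty finite subset of $\mathbb{Z}$ and let $X$ be a subset of $\mathbb{N}$. Then $X$ is $C$-admissible if and only if at least one of the following holds: (i) $X\subseteq\{0\}\cup\{n\in\mathbb{N} : n\ge\theta(C)\}$; (ii) $X\subseteq\left\langle\frac{\theta(C)}{2}\right\rangle$ and $C\subseteq\left\{k\frac{\theta(C)}{2} : k\in\{-2,-1\}\cup\mathbb{N}\right\}$.
   Context: $\mathbb{N}$ denotes the non-negative integers. For $C\subseteq\mathbb{Z}$, a $C$-incentive is a submonoid $M$ of $(\mathbb{N},+)$ such that $s+t+c\in M$ for all $s,t\in M\setminus\{0\}$ and all $c\in C$. A set $X\subseteq\mathbb{N}$ is $C$-admissible if there is at least one $C$-incentive containing $X$. $\theta(C)=-\min(C\cup\{0\})$. $\left\langle\frac{\theta(C)}{2}\right\rangle$ denotes the set $\{k\frac{\theta(C)}{2} : k\in\mathbb{N}\}$ (of rational numbers). *)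

(* Defs.v *)
From mathcomp Require Import all_boot all_order all_algebra finmap.
From mathcomp Require Import classical_sets.

Set Implicit Arguments.
Unset Strict Implicit.
Unset Printing Implicit Defensive.

Import Order.TTheory GRing.Theory Num.Theory.
Local Open Scope classical_set_scope.
Local Open Scope ring_scope.

Definition submonoid (M : set nat) : Prop := GRing.nmod_closed [in M].

(* s + t + c is an integer that may be negative: membership in M requires it
   to be the image in int of an element of M. *)
Definition incentive (C : set int) (M : set nat) : Prop :=
  submonoid M /\
  forall (s t : nat) (c : int), (M `\ 0%N) s -> (M `\ 0%N) t -> C c ->
    (Posz @` M) (s%:Z + t%:Z + c).

Definition admissible (C : set int) (X : set nat) : Prop :=
  exists M : set nat, incentive C M /\ X `<=` M.

(* The initial value 0 of the iterated minimum accounts for the element 0 of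
   C \cup {0}. *)
Definition theta (C : {fset int}) : int := - \big[Order.min/0]_(c <- C) c.

Definition half_theta (C : {fset int}) : rat := (theta C)%:~R / 2%:R.

Definition half_theta_multiples (C : {fset int}) : set rat :=
  [set q | exists k : nat, q = k%:R * half_theta C].

(* Main.v *)
(** If [0 < x < theta], then [- theta] lies in [C], so an incentive containing
    [x] is closed under the map [s |-> s - (theta - x)] away from [0];
    iterating it must end exactly at [0], so [theta - x] lies in the incentive
    and divides all of its elements.
    Exchanging the roles of [x] and [theta - x] forces [x = theta / 2]. *)
Require Import Defs.
From mathcomp Require Import all_boot all_order all_algebra finmap.
From mathcomp Require Import classical_sets zify.

Set Implicit Arguments.
Unset Strict Implicit.
Unset Printing Implicit Defensive.

Import Order.TTheory GRing.Theory Num.Theory.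
Local Open Scope classical_set_scope.
Local Open Scope ring_scope.

Lemma bigmin0_mem (s : seq int) :
  \big[Order.min/0]_(c <- s) c = 0 \/ \big[Order.min/0]_(c <- s) c \in s.
Proof.
elim: s => [|a s IH]; first by left; rewrite big_nil.
rewrite big_cons in_cons minEle; case: ifP => _; first by right; rewrite eqxx.
by case: IH => [->|->]; [left|right; rewrite orbT].
Qed.

Lemma theta_ge0 C : 0 <= theta C.
Proof. by rewrite /theta oppr_ge0 bigmin_le_id. Qed.

Lemma oppr_theta_le C (c : int) : c \in C -> - theta C <= c.
Proof. by move=> cC; rewrite /theta opprK; exact: ge_bigmin_seq. Qed.

(** A minimum equal to the initial value [0] would give [theta C = 0], so here the minimum is
    attained in [C]. *)
Lemma oppr_theta_mem C : 0 < theta C -> - theta C \in C.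
Proof.
rewrite /theta opprK => t_gt0.
by case: (bigmin0_mem C) => // e; rewrite e in t_gt0.
Qed.

Lemma submonoid_of_closed (M : set nat) :
  M 0%N -> (forall s t, M s -> M t -> M (s + t)%N) -> submonoid M.
Proof.
move=> M0 MD; split; first by rewrite !inE.
by move=> s t; rewrite !inE; exact: MD.
Qed.

(** Strong induction along [s, s - d, ...]: the chain stays in [M] and can stop only at [0], and its
    last nonzero term is [d]. *)
Lemma descent_dvdn (M : set nat) (d : nat) : (0 < d)%N ->
  (forall s, M s -> s <> 0%N -> exists2 r, M r & s = (r + d)%N) ->
  forall s, M s -> (d %| s)%N /\ (s <> 0%N -> M d).
Proof.
move=> d_gt0 descM; elim/ltn_ind => s IH Ms.
have [->|/eqP s_neq0] := eqVneq s 0%N; first by rewrite dvdn0.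
have [r Mr sE] := descM s Ms s_neq0.
have [dr rd] : (d %| r)%N /\ (r <> 0%N -> M d) by apply: IH => //; lia.
split=> [|_]; first by rewrite sE dvdn_addl.
have [r0|/eqP] := eqVneq r 0%N; last exact: rd.
by move: Ms; rewrite sE r0.
Qed.

Lemma incentive_theta_sub_dvdn (C : {fset int}) (M : set nat) (x y : nat) :
  incentive [set` C] M -> theta C = (x + y)%N%:Z -> M x ->
  (0 < x)%N -> (0 < y)%N -> M y /\ forall s, M s -> (y %| s)%N.
Proof.
move=> [_ MC] thE Mx x_gt0 y_gt0.
have thC : - theta C \in C by apply: oppr_theta_mem; lia.
have desc s : M s -> s <> 0%N -> exists2 r, M r & s = (r + y)%N.
  move=> Ms s0.
  (* The sum [s + x - theta C] equals [s - y]; its membership in the image of [Posz] rules out a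
     negative value, so [y <= s]. *)
  have [||r Mr rE] := MC s x (- theta C) _ _ thC.
  - by split.
  - by split=> // x0; rewrite x0 in x_gt0.
  by exists r => //; lia.
have dM := descent_dvdn y_gt0 desc.
split; last by move=> s /dM[].
by apply: (dM x Mx).2; lia.
Qed.

(** Of two nonzero elements, one absorbs [c >= - theta C] and the other keeps the sum at least
    [theta C]. *)
Lemma incentive_ge_theta (C : {fset int}) :
  incentive [set` C] ([set 0%N] `|` [set n : nat | theta C <= n%:Z]).
Proof.
have th0 := theta_ge0 C.
split.
  apply: submonoid_of_closed; first by left.
  move=> s t /= [->|Hs] [->|Ht]; [by left|right => /=; lia..].
move=> s t c [/= Hs s0] [/= Ht t0] /oppr_theta_le cth.
have {}Hs : theta C <= s%:Z by case: Hs.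
have {}Ht : theta C <= t%:Z by case: Ht.
by exists (absz (s%:Z + t%:Z + c)); [right => /=|]; lia.
Qed.

Lemma incentive_half_theta_multiples (C : {fset int}) :
  (fun c : int => c%:~R : rat) @` [set` C] `<=`
    [set q : rat | exists2 k : int,
       ([set -2; -1] `|` range Posz) k & q = k%:~R * half_theta C] ->
  incentive [set` C] [set n : nat | half_theta_multiples C n%:R].
Proof.
move=> CH; split.
  apply: submonoid_of_closed; first by exists 0%N; rewrite mul0r.
  move=> s t [a sE] [b tE]; exists (a + b)%N.
  by rewrite !natrD mulrDl sE tE.
move=> s t c [[a sE] s0] [[b tE] t0] Cc.
have [k kH cE] := CH _ (ex_intro2 _ _ c Cc erefl).
(* Nonzero elements have coefficients [a, b >= 1], which exactly offsets [k >= -2]: the new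
   coefficient [a + b + k] is a natural number. *)
have a0 : a <> 0%N.
  move=> a0; apply: s0; move/eqP: sE.
  by rewrite a0 mul0r pnatr_eq0 => /eqP.
have b0 : b <> 0%N.
  move=> b0; apply: t0; move/eqP: tE.
  by rewrite b0 mul0r pnatr_eq0 => /eqP.
have k_ge : -2 <= k by case: kH => [[->|->]|[j _ <-]] //; lia.
have h0 : 0 <= half_theta C.
  by rewrite /half_theta divr_ge0 // ler0z theta_ge0.
have mE : (absz (a%:Z + b%:Z + k))%:Z = a%:Z + b%:Z + k by lia.
have sumE : (s%:Z + t%:Z + c)%:~R = (absz (a%:Z + b%:Z + k))%:R * half_theta C.
  rewrite (pmulrn 1 (absz _)) mE !rmorphD /= -!pmulrn.
  by rewrite sE tE cE !mulrDl.
(* The sign is read off in [rat], where the sum is a natural multiple of [half_theta C >= 0]. *)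
have sum_ge0 : 0 <= s%:Z + t%:Z + c.
  by rewrite -(ler0z rat) sumE mulr_ge0 // ler0n.
exists (absz (s%:Z + t%:Z + c)); last by lia.
exists (absz (a%:Z + b%:Z + k)).
by rewrite -sumE (pmulrn 1 (absz _)) gez0_abs.
Qed.

Theorem proposition3p5 (C : {fset int}) (X : set nat) (hC : C <> fset0) :
  admissible [set` C] X <->
  X `<=` [set 0%N] `|` [set n : nat | theta C <= n%:Z]
  \/ ((fun n : nat => n%:R : rat) @` X `<=` half_theta_multiples C
      /\ (fun c : int => c%:~R : rat) @` [set` C] `<=`
           [set q : rat | exists2 k : int,
              ([set -2; -1] `|` range Posz) k & q = k%:~R * half_theta C]).
Proof.
split=> [[M [MC XM]]|[Xge|[XH CH]]]; last first.
- exists [set n : nat | half_theta_multiples C n%:R].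
  split; first exact: incentive_half_theta_multiples.
  by move=> n Xn; apply: XH; exists n.
- by exists ([set 0%N] `|` [set n : nat | theta C <= n%:Z]); split;
    [exact: incentive_ge_theta|].
have [|nXge] := boolp.EM (X `<=` [set 0%N] `|` [set n : nat | theta C <= n%:Z]).
  by left.
right.
have [x Xx [x_gt0 x_lt]] : exists2 x, X x & (0 < x)%N /\ x%:Z < theta C.
  apply: boolp.contrapT => nx; apply: nXge => x Xx /=.
  have [->|x0] := eqVneq x 0%N; first by left.
  right; rewrite leNgt; apply/negP => x_lt.
  by apply: nx; exists x => //; split=> //; rewrite lt0n.
pose y := absz (theta C - x%:Z).
have thxy : theta C = (x + y)%N%:Z by lia.
have y_gt0 : (0 < y)%N by lia.
have [My dvdy] := incentive_theta_sub_dvdn MC thxy (XM _ Xx) x_gt0 y_gt0.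
have thyx : theta C = (y + x)%N%:Z by lia.
have [Mx dvdx] := incentive_theta_sub_dvdn MC thyx My y_gt0 x_gt0.
(* Each of [x] and [y] lies in [M] and divides all of [M], hence each divides the other. *)
have xy : y = x by apply/eqP; rewrite eqn_dvd dvdx // dvdy.
have hE : half_theta C = x%:R.
  by rewrite /half_theta thxy xy -pmulrn natrD -mulr2n -(mulr_natr x%:R) mulfK.
split=> [_ [n Xn <-]|_ [c Cc <-]].
  exists (n %/ x)%N; rewrite hE -natrM divnK //.
  by apply: dvdx; exact: XM.
have xD0 : (M `\ 0%N) x by split=> //= x0; rewrite x0 in x_gt0.
(* The element [x + x + c] of [M] is a multiple [q * x] with [q] natural, so [c = (q - 2) * x]; the
   cases [q = 0] and [q = 1] produce the exceptional coefficients [-2] and [-1]. *)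
have [r Mr rE] := MC.2 x x c xD0 xD0 Cc.
have cE : c = ((r %/ x)%N%:Z - 2) * x%:Z.
  by have := divnK (dvdx r Mr); nia.
exists ((r %/ x)%N%:Z - 2); last by rewrite {1}cE rmorphM /= hE pmulrn.
case: (r %/ x)%N => [|[|k]]; [by left; left|by left; right|].
by right; exists k => //; lia.
Qed.
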